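(* Suppose that for every $n\ge 3$ we are given differentiable functions $f_1,f_n:\mathbb{R}^2\to\mathbb{R}$ and differentiable functions $f_2,\ldots,f_{n-1}:\mathbb{R}^3\to\mathbb{R}$ (which may depend on $n$), and consider the dynamical system on $\mathbb{R}^n$, $t=0,1,2,\ldots$, $$x_1(t+1)=f_1(x_1(t),x_2(t)),$$ $$x_i(t+1)=f_i(x_i(t),x_{i-1}(t),x_{i+1}(t)),\quad i=2,\ldots,n-1,$$ $$x_n(t+1)=f_n(x_{n-1}(t),x_n(t)).$$ Suppose that there exists a function $\tau(n,\epsilon)$, with values in the nonnegative integers, such that $$\frac{\|x(t)-\bar x\mathbf 1\|_2}{\|x(0)-\bar x\mathbf 1\|_2}<\epsilon$$ for all $n$ and all $\epsilon>0$, all $t\ge\tau(n,\epsilon)$, and all initial conditions $x_1(0),\ldots,x_n(0)$ for which not all $x_i(0)$ are equal. Then $$\tau(n,\epsilon)\ge\frac{n^2}{30}\log\frac1\epsilon$$ for all $\epsilon>0$ and $n\ge 3$.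
   Context: $\mathbf 1\in\mathbb{R}^n$ is the all-ones vector, $\bar x=\frac1n\sum_{i=1}^n x_i(0)$ is the average of the initial values, $x(t)=(x_1(t),\ldots,x_n(t))$, and $\|\cdot\|_2$ is the Euclidean norm. *)

(* Defs.v *)
From mathcomp Require Import all_boot all_order all_algebra.
From mathcomp Require Import all_classical all_reals all_analysis.

Set Implicit Arguments.
Unset Strict Implicit.
Unset Printing Implicit Defensive.

Import Order.TTheory GRing.Theory Num.Theory.
Import numFieldNormedType.Exports.

Local Open Scope ring_scope.

(* The library norm `|x| on 'rV[R]_n is the sup norm, not the Euclidean one. *)
Definition norm2 (R : realType) (n : nat) (x : 'rV[R]_n) : R :=
  Num.sqrt (\sum_(i < n) x 0 i ^+ 2).

Definition avg (R : realType) (n : nat) (x : 'rV[R]_n) : R :=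
  n%:R^-1 * \sum_(i < n) x 0 i.

(* Coordinates are numbered from 0: [f1] updates coordinate 0, [fn] updates
   coordinate n-1, and [fm i] updates an interior coordinate 0 < i < n-1; the
   value of [fm] at the two extreme indices is never used.  Although [ordS] and
   [ord_pred] are cyclic on 'I_n, they never wrap around here. *)
Definition step (R : realType) (n : nat) (f1 : R * R -> R)
    (fm : 'I_n -> R * R * R -> R) (fn : R * R -> R) (x : 'rV[R]_n) : 'rV[R]_n :=
  \row_(i < n)
    if i == 0%N :> nat then f1 (x 0 i, x 0 (ordS i))
    else if i == n.-1 :> nat then fn (x 0 (ord_pred i), x 0 i)
    else fm i (x 0 i, x 0 (ord_pred i), x 0 (ordS i)).

Definition state (R : realType) (n : nat) (f1 : R * R -> R)
    (fm : 'I_n -> R * R * R -> R) (fn : R * R -> R) (x0 : 'rV[R]_n) (t : nat) :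
    'rV[R]_n :=
  iter t (step f1 fm fn) x0.

(* Main.v *)
(* All consensus points c 1 are fixed by the update map F and F preserves the
   average, so the Jacobian A of F at 0 is tridiagonal with all row and column
   sums equal to 1, hence symmetric. Rescaling small initial conditions turns the
   convergence hypothesis into |u A^t| <= eps |u| for u orthogonal to 1 and
   t = tau(n, eps). If the bound failed, then eps < r^t with r = exp(-30/n^2), and
   log-convexity of k |-> |u A^k| would give |u A| <= r |u|, so the quadratic form
   of A would be bounded by r on the hyperplane orthogonal to 1. Applying this to
   the projections of the basis vectors bounds the trace of A from below, and
   applying it to a centred arithmetic progression then yields
   (1 - r) n (n + 1) <= 6 (1 + r), which is false for this r. *)
Require Import Defs.
From mathcomp Require Import all_boot all_order all_algebra.
From mathcomp Require Import all_classical all_reals all_analysis.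
From mathcomp Require Import ring lra zify.

Set Implicit Arguments.
Unset Strict Implicit.
Unset Printing Implicit Defensive.

Import Order.TTheory GRing.Theory Num.Theory.
Import numFieldNormedType.Exports.

Local Open Scope ring_scope.

(** * Euclidean inner product of row vectors and Cauchy-Schwarz *)

Definition dotrv (R : realType) (n : nat) (u v : 'rV[R]_n) : R :=
  \sum_(i < n) u 0 i * v 0 i.

Lemma dotrvE (R : realType) (n : nat) (u v : 'rV[R]_n) :
  dotrv u v = (u *m v^T) 0 0.
Proof. by rewrite mxE; apply: eq_bigr => i _; rewrite mxE. Qed.

Lemma dotrv_ge0 (R : realType) (n : nat) (u : 'rV[R]_n) : 0 <= dotrv u u.
Proof. by apply: sumr_ge0 => i _; rewrite -expr2 sqr_ge0. Qed.

Lemma dotrv_gt0 (R : realType) (n : nat) (u : 'rV[R]_n) :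
  u != 0 -> 0 < dotrv u u.
Proof.
move=> u0; rewrite lt_neqAle dotrv_ge0 andbT eq_sym; apply: contra u0.
rewrite psumr_eq0 => [/allP u0|i _]; last by rewrite -expr2 sqr_ge0.
apply/eqP/rowP => i; rewrite mxE; apply/eqP.
by have := u0 i (mem_index_enum i); rewrite mulf_eq0 orbb.
Qed.

Lemma dotrv_adjoint (R : realType) (n : nat) (A : 'M[R]_n) (u v : 'rV[R]_n) :
  A^T = A -> dotrv (u *m A) v = dotrv u (v *m A).
Proof. by move=> sA; rewrite !dotrvE trmx_mul sA mulmxA. Qed.

Lemma dotrv_CauchySchwarz (R : realType) (n : nat) (u v : 'rV[R]_n) :
  dotrv u v ^+ 2 <= dotrv u u * dotrv v v.
Proof.
have [->|/dotrv_gt0 v0] := eqVneq v 0.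
  by rewrite !dotrvE trmx0 !mulmx0 !mxE mulr0 expr0n.
have dotrvB (a b : R) : dotrv (a *: u - b *: v) (a *: u - b *: v)
    = a ^+ 2 * dotrv u u - 2 * a * b * dotrv u v + b ^+ 2 * dotrv v v.
  rewrite /dotrv !mulr_sumr -sumrB -big_split /=.
  by apply: eq_bigr => i _; rewrite !mxE; ring.
(* This vector is [dotrv v v] times the component of [u] orthogonal to [v]. *)
have := dotrv_ge0 (dotrv v v *: u - dotrv u v *: v).
rewrite dotrvB (_ : _ + _ = dotrv v v * (dotrv u u * dotrv v v - dotrv u v ^+ 2)).
  by rewrite pmulr_rge0 // subr_ge0.
by ring.
Qed.

Lemma norm2_sqr (R : realType) (n : nat) (u : 'rV[R]_n) :
  norm2 u ^+ 2 = dotrv u u.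
Proof. by rewrite /norm2 sqr_sqrtr ?sumr_ge0 // => i _; rewrite sqr_ge0. Qed.

(** * Log-convexity and powers of a symmetric matrix *)

(** The ratios of consecutive terms are nondecreasing, so the product of the first k of them is at
    least the k-th power of the first one. Denominators are cleared because terms may vanish. *)
Lemma logconvex_ratio_le (R : realFieldType) (d : nat -> R)
    (d_ge0 : forall k, 0 <= d k)
    (d_conv : forall k, d k.+1 ^+ 2 <= d k * d k.+2) (k : nat) :
  d 1 ^+ k * d 0 <= d k * d 0 ^+ k.
Proof.
have ratio j : d 1 * d j <= d 0 * d j.+1.
  elim: j => [|j IH]; first by rewrite mulrC.
  have [dj0|dj_neq0] := eqVneq (d j) 0.
    have := d_conv j; rewrite dj0 mul0r => dj1.
    have /eqP -> : d j.+1 == 0 by rewrite -sqrf_eq0 eq_le dj1 sqr_ge0.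
    by rewrite mulr0 mulr_ge0.
  have dj_gt0 : 0 < d j by rewrite lt_neqAle eq_sym dj_neq0 d_ge0.
  rewrite -(ler_pM2l dj_gt0).
  apply: (@le_trans _ _ (d 0 * d j.+1 ^+ 2)).
    rewrite expr2 mulrA; rewrite [leLHS](_ : _ = d 1 * d j * d j.+1); last by ring.
    by rewrite ler_wpM2r.
  by rewrite [leRHS](_ : _ = d 0 * (d j * d j.+2)) ?ler_wpM2l //; ring.
elim: k => [|k IH]; first by rewrite !expr0 mul1r mulr1.
rewrite exprS -mulrA; apply: (@le_trans _ _ (d 1 * (d k * d 0 ^+ k))).
  by rewrite ler_wpM2l.
rewrite mulrA exprS [leRHS](_ : _ = d 0 * d k.+1 * d 0 ^+ k); last by ring.
by rewrite ler_wpM2r ?exprn_ge0.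
Qed.

(* |uA^k| is log-convex in k, so its first ratio is at most the t-th root of
   |uA^t| / |u|. *)
Lemma dotrv_symm_power_bound (R : realType) (n : nat) (A : 'M[R]_n)
    (u : 'rV[R]_n) (t : nat) (r eps : R) :
  A^T = A -> 0 <= r -> 0 <= eps -> eps < r ^+ t ->
  dotrv (iter t (mulmxr A) u) (iter t (mulmxr A) u) <= eps ^+ 2 * dotrv u u ->
  dotrv (u *m A) (u *m A) <= r ^+ 2 * dotrv u u.
Proof.
move=> sA r0 eps0 epsr; pose w k := iter k (mulmxr A) u.
pose d k := dotrv (w k) (w k); rewrite -/(w t) -/(d t) -/(d 0) -/(d 1).
have [u0 _|u0] := eqVneq u 0.
  by rewrite /d /w /= u0 mul0mx !dotrvE mul0mx mxE mulr0.
have d0 : 0 < d 0 by exact: dotrv_gt0.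
have dge k : 0 <= d k by exact: dotrv_ge0.
move=> dt; have dlog : d 1 ^+ t * d 0 <= d t * d 0 ^+ t.
  apply: logconvex_ratio_le => // k.
  (* Symmetry moves one factor [A] across: the square of |uA^(k+1)| is the inner product of uA^k and
     uA^(k+2), to which Cauchy-Schwarz applies. *)
  rewrite {1}/d [w k.+1]/= /mulmxr dotrv_adjoint //.
  exact: dotrv_CauchySchwarz.
have d1t : d 1 ^+ t <= (r ^+ 2 * d 0) ^+ t.
  rewrite -(ler_pM2r d0); apply: (le_trans dlog).
  rewrite exprMn -mulrA [_ ^+ t * d 0]mulrC mulrA ler_wpM2r ?exprn_ge0 //.
  apply: (le_trans dt); rewrite ler_pM2r // exprAC.
  by rewrite lerXn2r ?nnegrE ?exprn_ge0 // ltW.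
case: t dt epsr d1t {dlog} => [|t] dt epsr d1t.
  (* No t-th root exists for t = 0, but then eps < 1 contradicts [dt], as [u] is nonzero. *)
  by move: dt; rewrite leNgt gtr_pMl // expr_lt1 // -(expr0 r) epsr.
by move: d1t; rewrite ler_pXn2r ?nnegrE // mulr_ge0 ?sqr_ge0.
Qed.

Lemma dotrv_symm_le (R : realType) (n : nat) (A : 'M[R]_n) (u : 'rV[R]_n)
    (r : R) :
  0 <= r -> dotrv (u *m A) (u *m A) <= r ^+ 2 * dotrv u u ->
  `|dotrv u (u *m A)| <= r * dotrv u u.
Proof.
move=> r0 h; rewrite -ler_sqr ?nnegrE ?mulr_ge0 ?dotrv_ge0 //.
rewrite real_normK ?num_real //; apply: (le_trans (dotrv_CauchySchwarz _ _)).
by rewrite exprMn expr2 mulrCA ler_wpM2l ?dotrv_ge0 // -?expr2.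
Qed.

(** * Symmetry of tridiagonal matrices with unit row and column sums *)

(** Cut the indices after i. The weight from the first i+1 rows to the later columns is i+1 minus
    the sum of the leading block, and the transpose has the same leading block sum. Tridiagonality
    leaves a single entry crossing the cut in each direction, so these two entries agree. *)
Lemma tridiag_doubly_stochastic_symm (R : realType) (n : nat) (A : 'M[R]_n)
    (tri : forall i j : 'I_n, (i.+1 < j)%N || (j.+1 < i)%N -> A i j = 0)
    (rows : forall i, \sum_j A i j = 1) (cols : forall j, \sum_i A i j = 1) :
  A^T = A.
Proof.
have cut (B : 'M[R]_n) (i j : 'I_n) : i.+1 = j :> nat ->
    (forall p q : 'I_n, (p.+1 < q)%N -> B p q = 0) ->
    \sum_(p < n | (p <= i)%N) \sum_(q < n | ~~ (q <= i)%N) B p q = B i j.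
  move=> ij B0; rewrite (bigD1 i) //= (bigD1 j) /=; last by rewrite -ltnNge -ij.
  rewrite big1 ?addr0 => [|q /andP[iq qj]]; last first.
    by rewrite B0 // ltn_neqAle [(i < q)%N]ltnNge iq andbT ij eq_sym.
  rewrite big1 ?addr0 // => p /andP[pi ip]; apply: big1 => q iq.
  have p_lt_i : (p < i)%N by rewrite ltn_neqAle pi andbT.
  by rewrite B0 // (leq_ltn_trans p_lt_i) // ltnNge.
have split (B : 'M[R]_n) (i : 'I_n) : (forall p, \sum_q B p q = 1) ->
    \sum_(p < n | (p <= i)%N) \sum_(q < n | ~~ (q <= i)%N) B p q
    = \sum_(p < n | (p <= i)%N) 1
      - \sum_(p < n | (p <= i)%N) \sum_(q < n | (q <= i)%N) B p q.
  move=> B1; rewrite -sumrB; apply: eq_bigr => p _.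
  rewrite -(B1 p) [in RHS](bigID (fun q : 'I_n => (q <= i)%N)) /=.
  by rewrite addrAC subrr add0r.
have superdiag (i j : 'I_n) : i.+1 = j :> nat -> A i j = A j i.
  move=> ij; rewrite -(cut A) // => [|p q pq]; last by rewrite tri ?pq.
  have -> : A j i = A^T i j by rewrite mxE.
  rewrite -(cut A^T) // => [|p q pq]; last by rewrite mxE tri ?pq ?orbT.
  rewrite !split // => [|p]; last by under eq_bigr do rewrite mxE; exact: cols.
  congr (_ - _); rewrite exchange_big /=; apply: eq_bigr => p _.
  by apply: eq_bigr => q _; rewrite mxE.
apply/matrixP => i j; rewrite mxE.
have [ij|ji|/val_inj -> //] := ltngtP i j.
- have [/eqP/superdiag -> //|ij'] := boolP (i.+1 == j).
  have {ij'}ij : (i.+1 < j)%N by rewrite ltn_neqAle ij'.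
  by rewrite !tri ?ij ?orbT.
- have [/eqP/superdiag -> //|ji'] := boolP (j.+1 == i).
  have {ji'}ji : (j.+1 < i)%N by rewrite ltn_neqAle ji'.
  by rewrite !tri ?ji ?orbT.
Qed.

(** * Trace bound and spectral gap inequality *)

(** The centre [c] is independent of n so that induction on n goes through; it is later set to n -
    1. *)
Lemma sum_centered (R : comNzRingType) (n : nat) (c : R) :
  \sum_(i < n) (2 * i%:R - c) = n%:R * (n%:R - 1 - c).
Proof.
elim: n => [|n IH]; first by rewrite big_ord0 mul0r.
by rewrite big_ord_recr /= IH -natr1; ring.
Qed.

Lemma sum_centered_sqr (R : comNzRingType) (n : nat) (c : R) :
  3 * \sum_(i < n) (2 * i%:R - c) ^+ 2
  = n%:R * (2 * (n%:R - 1) * (2 * n%:R - 1) - 6 * c * (n%:R - 1) + 3 * c ^+ 2).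
Proof.
elim: n => [|n IH]; first by rewrite big_ord0 mul0r mulr0.
by rewrite big_ord_recr /= mulrDr IH -natr1; ring.
Qed.

(** The projection of the i-th basis vector orthogonal to the all-ones vector has squared norm 1 -
    1/n, and the quadratic form of [A] takes the value A_ii - 1/n on it. Summing the lower bounds
    over i plays the role of bounding n - 1 eigenvalues below by -r, without diagonalization. *)
Lemma trace_ge (R : realType) (n : nat) (A : 'M[R]_n) (r : R) (n_gt0 : (0 < n)%N)
    (rows : forall i, \sum_j A i j = 1) (cols : forall j, \sum_i A i j = 1)
    (hA : forall u : 'rV[R]_n, \sum_i u 0 i = 0 ->
       `|dotrv u (u *m A)| <= r * dotrv u u) :
  1 - r * (n%:R - 1) <= \tr A.
Proof.
have n0 : n%:R != 0 :> R by rewrite pnatr_eq0 -lt0n.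
pose c : R := n%:R^-1; have nc : n%:R * c = 1 by rewrite mulfV.
have sum_delta (i : 'I_n) (g : 'I_n -> R) : \sum_k (k == i)%:R * g k = g i.
  rewrite (bigD1 i) //= eqxx mul1r big1 ?addr0 // => k /negPf ->.
  by rewrite mul0r.
have sum_const (a : R) : \sum_(k < n) a = n%:R * a.
  by rewrite sumr_const card_ord mulr_natl.
have diag (i : 'I_n) : - (r * (1 - c)) <= A i i - c.
  pose u : 'rV[R]_n := \row_k ((k == i)%:R - c).
  have uA k : (u *m A) 0 k = A i k - c.
    rewrite mxE; under eq_bigr do rewrite mxE mulrBl.
    by rewrite sumrB sum_delta -mulr_sumr cols mulr1.
  have dotu (g : 'I_n -> R) : \sum_k u 0 k * g k = g i - c * \sum_k g k.
    under eq_bigr do rewrite mxE mulrBl.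
    by rewrite sumrB sum_delta -mulr_sumr.
  have u0 : \sum_k u 0 k = 0.
    under eq_bigr do rewrite -[u _ _]mulr1.
    by rewrite dotu sum_const mulr1 mulrC nc subrr.
  have -> : A i i - c = dotrv u (u *m A).
    rewrite /dotrv dotu uA; under eq_bigr do rewrite uA.
    by rewrite sumrB rows sum_const nc subrr mulr0 subr0.
  have -> : 1 - c = dotrv u u by rewrite /dotrv dotu u0 mulr0 subr0 mxE eqxx.
  by have := hA u u0; rewrite ler_norml => /andP[].
have : \sum_(i < n) - (r * (1 - c)) <= \sum_(i < n) (A i i - c).
  by apply: ler_sum => i _; exact: diag.
rewrite sumrB !sum_const nc -/(\tr A).
have -> : n%:R * - (r * (1 - c)) = - (r * (n%:R - n%:R * c)) by ring.
by rewrite nc; lra.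
Qed.

(* Testing the quadratic form on the centred arithmetic progression: the
   entries of [A] off the diagonal then all get the same weight. *)
Lemma tridiag_gap_le (R : realType) (n : nat) (A : 'M[R]_n) (r : R)
    (n_gt1 : (1 < n)%N)
    (tri : forall i j : 'I_n, (i.+1 < j)%N || (j.+1 < i)%N -> A i j = 0)
    (rows : forall i, \sum_j A i j = 1) (cols : forall j, \sum_i A i j = 1)
    (hA : forall u : 'rV[R]_n, \sum_i u 0 i = 0 ->
       `|dotrv u (u *m A)| <= r * dotrv u u) :
  (1 - r) * (n%:R * (n%:R + 1)) <= 6 * (1 + r).
Proof.
have trA := trace_ge (ltnW n_gt1) rows cols hA.
pose x (i : nat) : R := 2 * i%:R - (n%:R - 1).
pose u : 'rV[R]_n := \row_i x i.
have u0 : \sum_i u 0 i = 0.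
  under eq_bigr do rewrite mxE.
  by rewrite sum_centered subrr mulr0.
have uu : 3 * dotrv u u = n%:R * (n%:R ^+ 2 - 1).
  rewrite /dotrv; under eq_bigr do rewrite mxE -expr2.
  by rewrite sum_centered_sqr; ring.
(* Dirichlet form of [A]: in the expanded square, unit row and column sums turn each pure square
   term into the squared norm. *)
have energy : \sum_i \sum_j A i j * (x i - x j) ^+ 2
    = 2 * dotrv u u - 2 * dotrv u (u *m A).
  have -> : 2 * dotrv u u
      = \sum_i \sum_j A i j * x i ^+ 2 + \sum_i \sum_j A i j * x j ^+ 2.
    rewrite [X in _ = _ + X]exchange_big /= -big_split /= /dotrv mulr_sumr.
    apply: eq_bigr => i _; rewrite -!mulr_suml rows cols !mxE; ring.
  have -> : dotrv u (u *m A) = \sum_i \sum_j A i j * (x i * x j).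
    rewrite exchange_big /=; apply: eq_bigr => j _.
    rewrite !mxE mulr_sumr; apply: eq_bigr => i _; rewrite mxE; ring.
  rewrite mulr_sumr -big_split -sumrB /=; apply: eq_bigr => i _.
  rewrite mulr_sumr -big_split -sumrB /=; apply: eq_bigr => j _; ring.
(* Diagonal terms vanish and neighbours differ by 2, so the energy is 4 times the sum of the
   off-diagonal entries. *)
have : \sum_i \sum_j A i j * (x i - x j) ^+ 2 = 4 * (n%:R - \tr A).
  have -> : n%:R = \sum_(i < n) 1 :> R by rewrite sumr_const card_ord.
  rewrite -sumrB mulr_sumr.
  apply: eq_bigr => i _.
  have -> : 1 - A i i = \sum_(j | j != i) A i j.
    by rewrite -(rows i) (bigD1 i) //= addrAC subrr add0r.
  rewrite mulr_sumr (bigD1 i) //= subrr expr0n mulr0 add0r.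
  apply: eq_bigr => j ji; rewrite mulrC.
  have [ij|] := boolP ((i.+1 < j)%N || (j.+1 < i)%N).
    by rewrite tri // !mulr0.
  rewrite negb_or -!leqNgt => /andP[ji1 ij1]; congr (_ * _); rewrite /x.
  have [ij|ij|/val_inj ij] := ltngtP i j; last by rewrite ij eqxx in ji.
  - have -> : j = i.+1 :> nat by apply/eqP; rewrite eqn_leq ji1.
    by rewrite -(natr1 i); ring.
  - have -> : i = j.+1 :> nat by apply/eqP; rewrite eqn_leq ij1.
    by rewrite -(natr1 j); ring.
rewrite energy => E.
have := hA u u0; rewrite ler_norml => /andP[_ uAu].
have n1 : 0 < n%:R - 1 :> R by rewrite subr_gt0 ltr1n.
(* The energy identity gives (1 - r)|u|^2 <= 2(n - tr A), and the trace bound gives n - tr A <= (n -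
   1)(1 + r); the factor n - 1 also divides 3|u|^2. *)
rewrite -(ler_pM2r n1).
have -> : (1 - r) * (n%:R * (n%:R + 1)) * (n%:R - 1) = (1 - r) * (3 * dotrv u u).
  by rewrite uu; ring.
lra.
Qed.

(** From e^x >= 1 + x at x = 30/n^2, r <= n^2/(n^2 + 30). The claim then reduces to 18n^2 + 30n >
    180, which holds from n = 3 on. *)
Lemma expR_gap_gt (R : realType) (n : nat) (r := expR (- (30 / n%:R ^+ 2)) : R) :
  (3 <= n)%N -> 6 * (1 + r) < (1 - r) * (n%:R * (n%:R + 1)).
Proof.
move=> n3; have {}n3 : 3 <= n%:R :> R by rewrite ler_nat.
have n2 : 0 < n%:R ^+ 2 :> R by rewrite exprn_gt0 //; lra.
have r0 : 0 < r by exact: expR_gt0.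
have rE : r * expR (30 / n%:R ^+ 2) = 1 by rewrite -expRD addNr expR0.
have re : r * (n%:R ^+ 2 + 30) <= n%:R ^+ 2.
  rewrite [leRHS](_ : _ = r * (n%:R ^+ 2 * expR (30 / n%:R ^+ 2))).
    rewrite ler_pM2l //.
    have -> : n%:R ^+ 2 + 30 = n%:R ^+ 2 * (1 + 30 / n%:R ^+ 2) :> R.
      by field; rewrite -sqrf_eq0 gt_eqF.
    by rewrite ler_pM2l // expR_ge1Dx.
  by rewrite mulrCA rE mulr1.
move: n3 n2 re r0; move: (n%:R) (r) => m s; nra.
Qed.

(** * Locality of the update map and its differential at 0 *)

Section Differential.
Local Open Scope classical_set_scope.

(** This locality is the source of the tridiagonal shape of the Jacobian. *)
Lemma step_local (R : realType) (n : nat) (f1 : R * R -> R)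
    (fm : 'I_n -> R * R * R -> R) (fn : R * R -> R) (x y : 'rV[R]_n) (i : 'I_n) :
  (1 < n)%N ->
  (forall j : 'I_n, ~~ ((j.+1 < i)%N || (i.+1 < j)%N) -> x 0 j = y 0 j) ->
  step f1 fm fn x 0 i = step f1 fm fn y 0 i.
Proof.
move=> n1 xy; rewrite !mxE.
have i_lt := ltn_ord i.
have self : x 0 i = y 0 i by apply: xy; lia.
have next : i != n.-1 :> nat -> x 0 (ordS i) = y 0 (ordS i).
  by move=> i1; apply: xy; rewrite /= modn_small; lia.
have prev : i != 0%N :> nat -> x 0 (ord_pred i) = y 0 (ord_pred i).
  move=> i0; apply: xy => /=.
  (* [ord_pred] reduces (i + n).-1 modulo n; for i > 0 this is i - 1, with no wrap-around. *)
  have -> : (i + n).-1 = (i.-1 + n)%N by lia.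
  by rewrite modnDr modn_small; lia.
have [i0|i0] := eqVneq (i : nat) 0%N; first by rewrite self next //; lia.
by have [i1|i1] := eqVneq (i : nat) n.-1; rewrite self prev // next.
Qed.

Lemma differentiable_row (R : realType) (V : normedModType R) (n : nat)
    (g : V -> 'rV[R]_n) (x : V) :
  (forall i, differentiable (fun y => g y 0 i) x) -> differentiable g x.
Proof.
move=> dg.
have -> : g = \sum_(i < n) (fun y => g y 0 i *: (delta_mx 0 i : 'rV[R]_n)).
  by apply/funext => y; rewrite fct_sumE; exact: row_sum_delta.
by apply: differentiable_sum => i; exact: differentiableZl.
Qed.

Lemma step_differentiable (R : realType) (n : nat) (f1 : R * R -> R)
    (fm : 'I_n -> R * R * R -> R) (fn : R * R -> R) (x : 'rV[R]_n) :
  (forall p, differentiable f1 p) ->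
  (forall i : 'I_n, (0 < i < n.-1)%N -> forall p, differentiable (fm i) p) ->
  (forall p, differentiable fn p) ->
  differentiable (step f1 fm fn) x.
Proof.
move=> df1 dfm dfn; apply: differentiable_row => i.
have coord (j : 'I_n) : differentiable (fun y : 'rV[R]_n => y 0 j) x.
  exact: differentiable_coord.
rewrite (_ : (fun y => _) = (fun y : 'rV[R]_n =>
    if i == 0%N :> nat then f1 (y 0 i, y 0 (ordS i))
    else if i == n.-1 :> nat then fn (y 0 (ord_pred i), y 0 i)
    else fm i (y 0 i, y 0 (ord_pred i), y 0 (ordS i)))); last first.
  by apply/funext => y; rewrite mxE.
have [i0|i0] := eqVneq (i : nat) 0%N.
  apply: (differentiable_comp
    (f := fun y : 'rV[R]_n => (y 0 i, y 0 (ordS i)))) => //.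
  exact: differentiable_pair.
have [i1|i1] := eqVneq (i : nat) n.-1.
  apply: (differentiable_comp
    (f := fun y : 'rV[R]_n => (y 0 (ord_pred i), y 0 i))) => //.
  exact: differentiable_pair.
apply: (differentiable_comp
  (f := fun y : 'rV[R]_n => (y 0 i, y 0 (ord_pred i), y 0 (ordS i)))).
  by apply: differentiable_pair => //; exact: differentiable_pair.
by apply: dfm; have := ltn_ord i; lia.
Qed.

(** The directional derivative is the limit of these quotients, and a closed set contains its
    limits. Every property of the Jacobian below is transferred from the map in this way. *)
Lemma diff0_closed (R : realType) (V W : normedModType R) (g : V -> W) (v : V)
    (P : set W) :
  differentiable g 0 -> g 0 = 0 -> closed P ->
  (forall h : R, h != 0 -> P (h^-1 *: g (h *: v))) -> P ('d g 0 v).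
Proof.
move=> dg g0 cP hP; rewrite -deriveE //.
have dv := @diff_derivable _ _ _ g 0 v dg.
apply: (closed_cvg P cP _ _ dv).
near=> h; rewrite /= addr0 g0 subr0; apply: hP.
by near: h; exact: nbhs_dnbhs_neq.
Unshelve. all: by end_near. Qed.

(** As 0 is fixed, every application of the chain rule uses the differential at 0 again. *)
Lemma iter_diff0 (R : realType) (V : normedModType R) (g : V -> V) (t : nat) :
  differentiable g 0 -> g 0 = 0 ->
  [/\ differentiable (iter t g) 0, iter t g 0 = 0
    & forall v, 'd (iter t g) 0 v = iter t ('d g 0) v].
Proof.
move=> dg g0; elim: t => [|t [dt t0 dE]].
  by split=> // v; rewrite -[iter 0 g]/(@idfun V) diff_val.
have gE : iter t.+1 g = g \o iter t g by [].
split; [|by rewrite /= t0|].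
  by rewrite gE; apply: differentiable_comp => //; rewrite t0.
move=> v; have dg' : differentiable g (iter t g 0) by rewrite t0.
have := congr1 (@^~ v) (diff_comp dt dg').
by rewrite t0 gE iterS -dE => ->.
Qed.

End Differential.

(** * Euclidean norm, averages and consensus vectors *)

Lemma norm2_gt0 (R : realType) (n : nat) (u : 'rV[R]_n) : u != 0 -> 0 < norm2 u.
Proof.
move=> /dotrv_gt0; rewrite -norm2_sqr => u0.
rewrite lt_neqAle sqrtr_ge0 andbT eq_sym; apply: contraTneq u0 => ->.
by rewrite expr0n ltxx.
Qed.

(** Turns Euclidean estimates into convergence for the library norm. *)
Lemma normr_le_norm2 (R : realType) (n : nat) (u : 'rV[R]_n) : `|u| <= norm2 u.
Proof.
rewrite [leLHS]mx_normrE; apply: bigmax_le => [|[i j] _ /=]; first exact: sqrtr_ge0.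
rewrite ord1 -sqrtr_sqr ler_sqrt ?sumr_ge0 // => [|k _]; last exact: sqr_ge0.
by rewrite (bigD1 j) //= lerDl sumr_ge0 // => k _; exact: sqr_ge0.
Qed.

Lemma avg_const (R : realType) (n : nat) (c : R) : (0 < n)%N ->
  avg (c *: const_mx 1 : 'rV[R]_n) = c.
Proof.
move=> n0; rewrite /avg; under eq_bigr do rewrite !mxE mulr1.
by rewrite sumr_const card_ord -[c *+ n]mulr_natl mulKf // pnatr_eq0 -lt0n.
Qed.

Lemma avg_eq0 (R : realType) (n : nat) (u : 'rV[R]_n) :
  \sum_i u 0 i = 0 -> avg u = 0.
Proof. by rewrite /avg => ->; rewrite mulr0. Qed.

Lemma consensus_dec (R : realType) (n : nat) (x : 'rV[R]_n) :
  (exists i j, x 0 i <> x 0 j) \/ x = avg x *: const_mx 1.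
Proof.
have [|cst] := pselect (exists i j, x 0 i <> x 0 j); [by left|right].
apply/rowP => i; have n0 : (0 < n)%N by exact: leq_ltn_trans (ltn_ord i).
have -> : x = x 0 i *: const_mx 1.
  apply/rowP => j; rewrite !mxE mulr1; apply: contrapT => xij.
  by apply: cst; exists j, i.
by rewrite avg_const.
Qed.

Lemma not_consensus (R : realType) (n : nat) (u : 'rV[R]_n) :
  u != 0 -> \sum_i u 0 i = 0 -> exists i j, u 0 i <> u 0 j.
Proof.
move=> u0 us; have [//|uE] := consensus_dec u.
by rewrite uE avg_eq0 // scale0r eqxx in u0.
Qed.

Section Consensus.
Local Open Scope classical_set_scope.

(** The hypothesis only concerns non-consensus starting points, so the consensus point is perturbed
    by a vector of zero sum. The perturbed orbit still converges to it, and by continuity the limit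
    of an orbit is fixed. *)
Lemma consensus_fixed (R : realType) (n : nat) (F : 'rV[R]_n -> 'rV[R]_n) (c : R) :
  (1 < n)%N -> continuous F ->
  (forall x : 'rV[R]_n, (exists i j, x 0 i <> x 0 j) ->
     iter t F x @[t --> \oo] --> (avg x *: const_mx 1 : 'rV[R]_n)) ->
  F (c *: const_mx 1) = c *: const_mx 1.
Proof.
move=> n1 cF conv; have n0 := ltnW n1.
pose i0 := Ordinal n0; pose i1 := Ordinal n1.
pose d : 'rV[R]_n := delta_mx 0 i0 - delta_mx 0 i1.
pose x : 'rV[R]_n := c *: const_mx 1 + d.
have d_sum : \sum_i d 0 i = 0.
  under eq_bigr do rewrite !mxE eqxx /=.
  have delta_sum (k : 'I_n) : \sum_i (i == k)%:R = 1 :> R.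
    by rewrite (bigD1 k) //= eqxx big1 ?addr0 // => i /negPf ->.
  by rewrite sumrB !delta_sum subrr.
have xE : avg x = c.
  rewrite /avg; under eq_bigr do rewrite mxE.
  by rewrite big_split /= d_sum addr0 -/(avg _) avg_const.
have xN : exists i j, x 0 i <> x 0 j.
  exists i0, i1; rewrite !mxE !eqxx /= => /addrI; rewrite subr0 sub0r; lra.
have := conv x xN; rewrite xE => cx.
have cFx : F (iter t F x) @[t --> \oo] --> F (c *: const_mx 1).
  apply: continuous_cvg; [exact: cF | exact: cx].
have cx' : iter t.+1 F x @[t --> \oo] --> (c *: const_mx 1 : 'rV[R]_n).
  by rewrite (cvg_shiftS (fun t => iter t F x)).
exact: norm_cvg_unique cFx cx'.
Qed.

(** The orbit of [F x] is the shifted orbit of [x], so both have the same limit, which determines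
    the average. *)
Lemma avg_preserved (R : realType) (n : nat) (F : 'rV[R]_n -> 'rV[R]_n)
    (x : 'rV[R]_n) :
  (0 < n)%N -> (forall c, F (c *: const_mx 1) = c *: const_mx 1) ->
  (forall x : 'rV[R]_n, (exists i j, x 0 i <> x 0 j) ->
     iter t F x @[t --> \oo] --> (avg x *: const_mx 1 : 'rV[R]_n)) ->
  avg (F x) = avg x.
Proof.
move=> n0 fixF conv.
(* Convergence is extended to consensus vectors, since [x] or [F x] may be one. *)
have {}conv y : iter t F y @[t --> \oo] --> (avg y *: const_mx 1 : 'rV[R]_n).
  have [|->] := consensus_dec y; first exact: conv.
  rewrite avg_const //; under eq_cvg do rewrite iter_fix //.
  exact: cvg_cst.
have cFx : iter t.+1 F x @[t --> \oo] --> (avg (F x) *: const_mx 1 : 'rV[R]_n).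
  by under eq_cvg do rewrite iterSr; exact: conv.
have cx : iter t.+1 F x @[t --> \oo] --> (avg x *: const_mx 1 : 'rV[R]_n).
  by rewrite (cvg_shiftS (fun t => iter t F x)); exact: conv.
by rewrite -[LHS](avg_const _ n0) (norm_cvg_unique cFx cx) avg_const.
Qed.

Lemma dotrv_self_continuous (R : realType) (n : nat) :
  continuous (fun u : 'rV[R]_n => dotrv u u).
Proof.
move=> u; apply: (@cvg_big _ _ _ _ _ _ _ (nbhs u)) => [|i _].
  exact: add_continuous.
by apply: cvgM; exact: coord_continuous.
Qed.

Lemma sum_coord_continuous (R : realType) (n : nat) :
  continuous (fun u : 'rV[R]_n => \sum_i u 0 i).
Proof.
move=> u; apply: (@cvg_big _ _ _ _ _ _ _ (nbhs u)) => [|i _].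
  exact: add_continuous.
exact: coord_continuous.
Qed.

(** The vector uA^t is the limit of F^t(hu)/h as h tends to 0. Since hu has average 0, the
    contraction hypothesis bounds each quotient by eps |u|, and the non-strict bound survives the
    limit. *)
Lemma linearization_contracts (R : realType) (n : nat) (F : 'rV[R]_n -> 'rV[R]_n)
    (A : 'M[R]_n) (u : 'rV[R]_n) (t : nat) (eps : R) :
  differentiable F 0 -> F 0 = 0 -> (forall v, 'd F 0 v = v *m A) -> 0 <= eps ->
  \sum_i u 0 i = 0 ->
  (forall x : 'rV[R]_n, (exists i j, x 0 i <> x 0 j) ->
     norm2 (iter t F x - avg x *: const_mx 1) / norm2 (x - avg x *: const_mx 1)
       < eps) ->
  dotrv (iter t (mulmxr A) u) (iter t (mulmxr A) u) <= eps ^+ 2 * dotrv u u.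
Proof.
move=> dF F0 FA eps0 us contr.
have [dFt Ft0 FtE] := iter_diff0 t dF F0.
have -> : iter t (mulmxr A) u = 'd (iter t F) 0 u.
  by rewrite FtE; apply: eq_iter => v; rewrite FA.
apply: (@diff0_closed _ _ _ (iter t F) u
    [set w | dotrv w w <= eps ^+ 2 * dotrv u u]) => //.
  apply: (preimage_closed (f := fun w : 'rV[R]_n => dotrv w w) _ (@closed_le _ _)).
  by move=> w _; exact: dotrv_self_continuous.
move=> h h0 /=.
have dotZ (a : R) (w : 'rV[R]_n) : dotrv (a *: w) (a *: w) = a ^+ 2 * dotrv w w.
  by rewrite /dotrv mulr_sumr; apply: eq_bigr => i _; rewrite !mxE; ring.
have [->|u0] := eqVneq u 0.
  by rewrite !scaler0 Ft0 scaler0 dotrvE mul0mx mxE mulr0.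
have hu0 : h *: u != 0 by rewrite scaler_eq0 negb_or h0.
have hus : \sum_i (h *: u) 0 i = 0.
  by under eq_bigr do rewrite mxE; rewrite -mulr_sumr us mulr0.
have := contr _ (not_consensus hu0 hus).
rewrite avg_eq0 // scale0r !subr0 ltr_pdivrMr ?norm2_gt0 // => /ltW le_eps.
rewrite dotZ exprVn mulrC ler_pdivrMr ?exprn_even_gt0 //.
rewrite -mulrA [_ * h ^+ 2]mulrC -dotZ -!norm2_sqr -exprMn.
by rewrite lerXn2r ?nnegrE ?mulr_ge0 ?sqrtr_ge0.
Qed.

End Consensus.

(** * Convergence to the average and the lower bound on [tau] *)

Lemma averaging_cvg (R : realType) (n : nat) (F : 'rV[R]_n -> 'rV[R]_n)
    (T : R -> nat) :
  (forall (eps : R) (t : nat) (x : 'rV[R]_n), 0 < eps -> (T eps <= t)%N ->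
     (exists i j, x 0 i <> x 0 j) ->
     norm2 (iter t F x - avg x *: const_mx 1) / norm2 (x - avg x *: const_mx 1)
       < eps) ->
  forall x : 'rV[R]_n, (exists i j, x 0 i <> x 0 j) ->
  (iter t F x @[t --> \oo] --> (avg x *: const_mx 1 : 'rV[R]_n))%classic.
Proof.
move=> hT x xN; apply/cvgrPdistC_lt => e e0.
have N0 : 0 < norm2 (x - avg x *: const_mx 1).
  apply: norm2_gt0; rewrite subr_eq0; apply/eqP => xE.
  by case: xN => i [j]; rewrite xE !mxE.
near=> t; apply: le_lt_trans (normr_le_norm2 _) _.
(* This tolerance converts the relative error into the absolute error [e]. *)
have := hT (e / norm2 (x - avg x *: const_mx 1)) t x.
rewrite ltr_pM2r ?invr_gt0 //; apply => //; first exact: divr_gt0.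
by near: t; exact: nbhs_infty_ge.
Unshelve. all: by end_near. Qed.

Theorem theorem6p1 (R : realType)
  (f1 : nat -> R * R -> R)
  (fm : forall n : nat, 'I_n -> R * R * R -> R)
  (fn : nat -> R * R -> R)
  (df1 : forall n : nat, (3 <= n)%N -> forall p : R * R, differentiable (f1 n) p)
  (dfm : forall n : nat, (3 <= n)%N -> forall i : 'I_n, (0 < i < n.-1)%N ->
     forall p : R * R * R, differentiable (fm n i) p)
  (dfn : forall n : nat, (3 <= n)%N -> forall p : R * R, differentiable (fn n) p)
  (tau : nat -> R -> nat)
  (htau : forall (n : nat) (eps : R) (t : nat) (x0 : 'rV[R]_n),
     (3 <= n)%N -> 0 < eps -> (tau n eps <= t)%N ->
     (exists i j : 'I_n, x0 0 i <> x0 0 j) ->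
     norm2 (state (f1 n) (@fm n) (fn n) x0 t - avg x0 *: const_mx 1)
       / norm2 (x0 - avg x0 *: const_mx 1) < eps)
  (n : nat) (eps : R) (hn : (3 <= n)%N) (heps : 0 < eps) :
  n%:R ^+ 2 / 30 * ln (1 / eps) <= (tau n eps)%:R.
Proof.
have n1 : (1 < n)%N by exact: leq_trans hn.
have n0 := ltnW n1.
pose F := step (f1 n) (@fm n) (fn n).
have dF x : differentiable F x.
  by apply: step_differentiable; [exact: df1 | exact: dfm | exact: dfn].
have cF : continuous F by move=> x; exact: differentiable_continuous.
have conv := averaging_cvg (fun e t x e0 te => @htau n e t x hn e0 te).
have fixF c : F (c *: const_mx 1) = c *: const_mx 1.
  exact: consensus_fixed.
have avgF x : avg (F x) = avg x by exact: avg_preserved.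
have F0 : F 0 = 0 by rewrite -[in LHS](scale0r (const_mx 1)) fixF scale0r.
have [A FA] : exists A : 'M[R]_n, forall v, 'd F 0 v = v *m A.
  by exists (lin1_mx ('d F 0)) => v; rewrite mul_rV_lin1.
(* Vectors are rows, so [A i j] is the derivative of coordinate j in variable i: row sums reflect
   preservation of the average, column sums the fixed consensus points. *)
have AE i j : A i j = ((delta_mx 0 i : 'rV[R]_n) *m A) 0 j by rewrite -rowE mxE.
have tri (i j : 'I_n) : (i.+1 < j)%N || (j.+1 < i)%N -> A i j = 0.
  move=> ij; rewrite AE -FA.
  apply: (@diff0_closed _ _ _ F (delta_mx 0 i) [set w | w 0 j = 0]) => //.
    apply: (preimage_closed (f := fun w : 'rV[R]_n => w 0 j) _ (@closed_eq _ _)).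
    by move=> w _; exact: coord_continuous.
  move=> h _ /=.
  (* Perturbing coordinate i alone does not reach coordinate j in one step. *)
  have Fj : F (h *: delta_mx 0 i) 0 j = F 0 0 j.
    apply: step_local => // k jk; rewrite !mxE /=.
    have [ki|] := eqVneq k i; last by rewrite mulr0.
    by rewrite ki ij in jk.
  by rewrite mxE Fj F0 mxE mulr0.
have rows i : \sum_j A i j = 1.
  under eq_bigr do rewrite AE; rewrite -FA.
  apply: (@diff0_closed _ _ _ F (delta_mx 0 i) [set w | \sum_j w 0 j = 1]) => //.
    apply: (preimage_closed
      (f := fun w : 'rV[R]_n => \sum_j w 0 j) _ (@closed_eq _ _)).
    by move=> w _; exact: sum_coord_continuous.
  move=> h h0 /=; under eq_bigr do rewrite mxE.
  rewrite -mulr_sumr.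
  rewrite (_ : \sum_j F _ 0 j = n%:R * avg (F (h *: delta_mx 0 i))); last first.
    by rewrite /avg mulVKf // pnatr_eq0 -lt0n.
  rewrite avgF /avg mulVKf ?pnatr_eq0 -?lt0n // (bigD1 i) //= big1 => [|j ji].
    by rewrite addr0 !mxE !eqxx mulr1 mulVf.
  by rewrite !mxE (negPf ji) andbF mulr0.
have cols j : \sum_i A i j = 1.
  transitivity (('d F 0 (const_mx 1)) 0 j).
    by rewrite FA mxE; apply: eq_bigr => i _; rewrite mxE mul1r.
  apply: (@diff0_closed _ _ _ F (const_mx 1) [set w | w 0 j = 1]) => //.
    apply: (preimage_closed (f := fun w : 'rV[R]_n => w 0 j) _ (@closed_eq _ _)).
    by move=> w _; exact: coord_continuous.
  (* Along the all-ones direction the difference quotient is constant. *)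
  by move=> h h0 /=; rewrite fixF scalerA mulVf // !mxE mulr1.
have sA := tridiag_doubly_stochastic_symm tri rows cols.
pose r := expR (- (30 / n%:R ^+ 2)) : R.
have r0 : 0 <= r by exact: expR_ge0.
rewrite leNgt; apply/negP => hlt.
(* Exponentiating the negated bound gives eps < exp(-30 tau / n^2). *)
have eps_lt : eps < r ^+ tau n eps.
  rewrite -expRM_natr -[ltLHS](lnK heps) ltr_expR.
  move: hlt; rewrite div1r lnV // => hlt.
  have n2 : 0 < n%:R ^+ 2 :> R by rewrite exprn_gt0 // ltr0n.
  rewrite mulNr ltrNr mulrAC ltr_pdivrMr //.
  by move: hlt; lra.
(* The rest derives the reverse inequality, using contraction at the time [tau n eps] itself. *)
have := expR_gap_gt R hn; apply/negP; rewrite -leNgt.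
apply: (@tridiag_gap_le R n A) => // u us.
apply: dotrv_symm_le => //.
apply: (dotrv_symm_power_bound sA r0 (ltW heps) eps_lt).
apply: (@linearization_contracts R n F A) => //; first exact: ltW.
by move=> x; exact: htau.
Qed.
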